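(* Let $\varphi$ be a normal $\mathrm{IA}$-automorphism of $L_{m,c}$. Then $\varphi$ is a generalized inner automorphism.
   Context: $K$ is a field of characteristic $0$, and $m\ge 2$, $c\ge 1$ are integers. $L_m$ is the free Lie algebra over $K$ with free generators $y_1,\ldots,y_m$, and $L_{m,c}=L_m/(L_m''+L_m^{c+1})$ is the free metabelian nilpotent of class $c$ Lie algebra, where $L_m''=[[L_m,L_m],[L_m,L_m]]$ and $L_m^{k}$ is the $k$-th term of the lower central series ($L_m^1=L_m$). Its free generators are $x_i=y_i+(L_m''+L_m^{c+1})$, $i=1,\ldots,m$. The operator $\mathrm{ad}\,v$ acts on the right: $u(\mathrm{ad}\,v)=[u,v]$. The operators $\mathrm{ad}\,x_1,\ldots,\mathrm{ad}\,x_m$ commute when acting on $L_{m,c}'=[L_{m,c},L_{m,c}]$, so $K[\mathrm{ad}\,x_1,\ldots,\mathrm{ad}\,x_m]$ denotes polynomials in these commuting operators, acting on the right on $L_{m,c}'$. An automorphism $\varphi$ of $L_{m,c}$ is normal if $\varphi(I)=I$ for every ideal $I$ of $L_{m,c}$. An $\mathrm{IA}$-automorphism is an automorphism inducing the identity map on $L_{m,c}/L_{m,c}'$. A generalized inner automorphism is an automorphism $\psi$ of $L_{m,c}$ of the form \[ \psi: x_i\mapsto x_i+\sum_{j=1}^{m}[x_i,x_j]f_j,\quad i=1,\ldots,m, \] where $f_j\in K[\mathrm{ad}\,x_1,\ldots,\mathrm{ad}\,x_m]$ (the same $f_1,\ldots,f_m$ for all $i$). *)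

(* Defs.v *)
From HB Require Import structures.
From mathcomp Require Import all_boot all_order all_algebra.
From mathcomp Require Import generic_quotient.
From mathcomp Require Import mpoly.
From mathcomp Require Import boolp classical_sets.

Set Implicit Arguments.
Unset Strict Implicit.
Unset Printing Implicit Defensive.

Import GRing.Theory.
Local Open Scope ring_scope.
Local Open Scope quotient_scope.
Local Open Scope classical_set_scope.

HB.mixin Record Lmodule_isLieAlgebra (K : fieldType) L of GRing.Lmodule K L := {
  lie : L -> L -> L;
  liePl : forall a u v w, lie (a *: u + v) w = a *: lie u w + lie v w;
  liePr : forall a u v w, lie w (a *: u + v) = a *: lie w u + lie w v;
  lievv : forall u, lie u u = 0;
  lie_jacobi : forall u v w,
    lie u (lie v w) + lie v (lie w u) + lie w (lie u v) = 0
}.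

#[short(type="lieAlgType")]
HB.structure Definition LieAlgebra (K : fieldType) :=
  {L of GRing.Lmodule K L & Lmodule_isLieAlgebra K L}.

Notation "[lie u , v ]" := (lie u v)
  (at level 0, format "[lie  u ,  v ]") : ring_scope.

Section LieBasics.
Variables (K : fieldType) (L : lieAlgType K).
Implicit Types (u v w : L) (A B : set L).

Lemma lieDl u v w : [lie u + v, w] = [lie u, w] + [lie v, w].
Proof. by have := liePl 1 u v w; rewrite !scale1r. Qed.

Lemma lieDr u v w : [lie w, u + v] = [lie w, u] + [lie w, v].
Proof. by have := liePr 1 u v w; rewrite !scale1r. Qed.

Lemma lie0l v : [lie 0, v] = 0.
Proof. by apply: (@addIr _ [lie 0, v]); rewrite -lieDl !add0r. Qed.

Lemma lie0r v : [lie v, 0] = 0.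
Proof. by apply: (@addIr _ [lie v, 0]); rewrite -lieDr !add0r. Qed.

Lemma lieZl a u v : [lie a *: u, v] = a *: [lie u, v].
Proof. by have := liePl a u 0 v; rewrite lie0l !addr0. Qed.

Lemma lieZr a u v : [lie v, a *: u] = a *: [lie v, u].
Proof. by have := liePr a u 0 v; rewrite lie0r !addr0. Qed.

Lemma lieNl u v : [lie - u, v] = - [lie u, v].
Proof. by rewrite -scaleN1r lieZl scaleN1r. Qed.

Lemma lieNr u v : [lie v, - u] = - [lie v, u].
Proof. by rewrite -scaleN1r lieZr scaleN1r. Qed.

Lemma lieC u v : [lie u, v] = - [lie v, u].
Proof.
apply/eqP; rewrite -addr_eq0; have /eqP := lievv (u + v).
by rewrite lieDl !lieDr !lievv add0r addr0.
Qed.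

Lemma lieA u v w : [lie [lie u, v], w] = [lie u, [lie v, w]] - [lie v, [lie u, w]].
Proof.
have := lie_jacobi u v w; rewrite (lieC w [lie u, v]) (lieC w u) lieNr.
by move/eqP; rewrite subr_eq0 => /eqP.
Qed.

Definition is_subspace A := A 0 /\ forall a u v, A u -> A v -> A (a *: u + v).

Definition is_ideal A := is_subspace A /\ forall u v, A u -> A [lie u, v].

Definition lie_prod A B : set L :=
  smallest is_subspace [set [lie u, v] | u in A & v in B].

Definition set_add A B : set L := [set u + v | u in A & v in B].

(* The derived algebra L' and the second derived algebra L''. *)
Definition derived1 : set L := lie_prod setT setT.
Definition derived2 : set L := lie_prod derived1 derived1.

(* Indexed from 1, so that lower_central 1 = L (and lower_central 0 = L too). *)
Definition lower_central (k : nat) : set L :=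
  iter k.-1 (fun A => lie_prod A setT) setT.

Lemma smallest_subspace A : is_subspace (smallest is_subspace A).
Proof.
split=> [B [[]]//|a u v Au Av B BP]; have [[_ +] _] := BP.
by apply; [apply: Au|apply: Av].
Qed.

Lemma lie_prod_sub A B C : is_subspace C ->
  (forall u v, A u -> B v -> C [lie u, v]) -> lie_prod A B `<=` C.
Proof. by move=> CP ABC; apply: smallest_sub => // _ [u Au [v Bv <-]]; apply: ABC. Qed.

Lemma lie_prod_in A B u v : A u -> B v -> lie_prod A B [lie u, v].
Proof. by move=> Au Bv; apply: sub_gen_smallest; exists u => //; exists v. Qed.

Lemma is_idealT : is_ideal setT. Proof. by []. Qed.

Lemma lie_prod_ideal A B : is_ideal A -> is_ideal B -> is_ideal (lie_prod A B).
Proof.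
move=> [_ iA] [_ iB]; have PS := smallest_subspace [set [lie u, v] | u in A & v in B].
split=> // u v; move: u.
apply: (@lie_prod_sub A B (fun u => lie_prod A B [lie u, v])).
  split=> [|a x y ABx ABy]; first by rewrite lie0l; case: PS.
  by rewrite liePl; apply: PS.2.
move=> x y Ax By; rewrite lieA -scaleN1r addrC.
apply: PS.2; last by apply: lie_prod_in => //; apply: iB.
rewrite lieC -scaleN1r -[_ *: _]addr0; apply: PS.2; last exact: PS.1.
by apply: lie_prod_in => //; apply: iA.
Qed.

Lemma set_add_ideal A B : is_ideal A -> is_ideal B -> is_ideal (set_add A B).
Proof.
move=> [[A0 AD] iA] [[B0 BD] iB]; split; first split.
- by exists 0 => //; exists 0 => //; rewrite addr0.
- move=> a _ _ [u Au [v Bv <-]] [u' Au' [v' Bv' <-]].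
  exists (a *: u + u'); first exact: AD.
  by exists (a *: v + v'); [exact: BD|rewrite scalerDr addrACA].
- move=> _ w [u Au [v Bv <-]]; exists [lie u, w]; first exact: iA.
  by exists [lie v, w]; [exact: iB|rewrite lieDl].
Qed.

Lemma derived1_ideal : is_ideal derived1.
Proof. exact: lie_prod_ideal. Qed.

Lemma derived2_ideal : is_ideal derived2.
Proof. by apply: lie_prod_ideal; exact: derived1_ideal. Qed.

Lemma lower_central_ideal k : is_ideal (lower_central k).
Proof.
rewrite /lower_central; elim: k.-1 => //= n IH.
by apply: lie_prod_ideal => //; exact: is_idealT.
Qed.

End LieBasics.

Arguments derived1 {K} L.
Arguments derived2 {K} L.
Arguments lower_central {K} L k.

Record lieIdeal (K : fieldType) (L : lieAlgType K) := LieIdeal {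
  ideal_set : set L;
  ideal_setP : is_ideal ideal_set
}.

Module LieQuotient.
Section LieQuotient.
Variables (K : fieldType) (L : lieAlgType K) (I : lieIdeal L).

Let I0 : ideal_set I 0. Proof. by case: (ideal_setP I) => -[]. Qed.
Let IP a u v : ideal_set I u -> ideal_set I v -> ideal_set I (a *: u + v).
Proof. by case: (ideal_setP I) => -[_ +] _; apply. Qed.
Let IN u : ideal_set I u -> ideal_set I (- u).
Proof. by move=> Iu; rewrite -scaleN1r -[_ *: _]addr0; apply: IP. Qed.
Let ID u v : ideal_set I u -> ideal_set I v -> ideal_set I (u + v).
Proof. by move=> Iu; rewrite -[X in X + _]scale1r; apply: IP. Qed.
Let ILl u v : ideal_set I u -> ideal_set I [lie u, v].
Proof. by case: (ideal_setP I) => _; apply. Qed.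
Let ILr u v : ideal_set I v -> ideal_set I [lie u, v].
Proof. by move=> Iv; rewrite lieC; apply/IN/ILl. Qed.

Definition equiv (u v : L) : bool := `[< ideal_set I (u - v) >].

Lemma equiv_is_equiv : equiv_class_of equiv.
Proof.
split=> [u|u v|v u w]; rewrite /equiv.
- by apply/asboolP; rewrite subrr.
- by apply: asbool_equiv_eq; split=> /IN; rewrite opprB.
- move=> /asboolP Iuv /asboolP Ivw; apply/asboolP.
  by rewrite -(subrK v u) -addrA; apply: ID.
Qed.

Canonical equiv_equiv := EquivRelPack equiv_is_equiv.
Canonical equiv_encModRel := defaultEncModRel equiv.

Definition quot := {eq_quot equiv}.
#[export]
HB.instance Definition _ : EqQuotient L equiv quot := EqQuotient.on quot.
#[export]
HB.instance Definition _ := Choice.on quot.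

Lemma pi_eq (u v : L) : (\pi_quot u = \pi_quot v) <-> ideal_set I (u - v).
Proof.
by split=> [/eqP|/asboolP uv]; [rewrite piE => /asboolP|apply/eqP; rewrite piE].
Qed.

Definition zero : quot := lift_cst quot 0.
Definition add := lift_op2 quot +%R.
Definition opp := lift_op1 quot -%R.
Definition scale (a : K) := lift_op1 quot ( *:%R a).
Definition bracket := lift_op2 quot (@lie K L).

Lemma pi_add : {morph \pi_quot : u v / u + v >-> add u v}.
Proof.
move=> u v; unlock add; apply/pi_eq.
rewrite opprD addrACA; apply: ID; apply/pi_eq; by rewrite reprK.
Qed.

Lemma pi_opp : {morph \pi_quot : u / - u >-> opp u}.
Proof. by move=> u; unlock opp; apply/pi_eq; rewrite -opprD; apply/IN/pi_eq; rewrite reprK. Qed.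

Lemma pi_scale a : {morph \pi_quot : u / a *: u >-> scale a u}.
Proof.
move=> u; unlock scale; apply/pi_eq.
by rewrite -scalerBr -[_ *: _]addr0; apply: IP => //; apply/pi_eq; rewrite reprK.
Qed.

Lemma pi_bracket : {morph \pi_quot : u v / [lie u, v] >-> bracket u v}.
Proof.
move=> u v; unlock bracket; apply/pi_eq; set u' := repr _; set v' := repr _.
have -> : [lie u, v] - [lie u', v'] = [lie u - u', v] + [lie u', v - v'].
  by rewrite lieDl lieDr lieNl lieNr addrA subrK.
by apply: ID; [apply: ILl|apply: ILr]; apply/pi_eq; rewrite reprK.
Qed.

Let piE := (pi_add, pi_opp, pi_scale, pi_bracket).
Let quotW (P : quot -> Prop) : (forall u, P (\pi_quot u)) -> forall x, P x.
Proof. by move=> Ppi x; rewrite -[x]reprK. Qed.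

Let addA : associative add.
Proof. by do 3!elim/quotW=> ?; rewrite -!piE addrA. Qed.
Let addC : commutative add.
Proof. by do 2!elim/quotW=> ?; rewrite -!piE addrC. Qed.
Let add0 : left_id (\pi_quot 0) add.
Proof. by elim/quotW=> ?; rewrite -!piE add0r. Qed.
Let addN : left_inverse (\pi_quot 0) opp add.
Proof. by elim/quotW=> ?; rewrite -!piE addNr. Qed.

#[export]
HB.instance Definition _ := GRing.isZmodule.Build quot addA addC add0 addN.

Let scaleA a b x : scale a (scale b x) = scale (a * b) x.
Proof. by elim/quotW: x => ?; rewrite -!piE scalerA. Qed.
Let scale1 : left_id 1 scale.
Proof. by elim/quotW=> ?; rewrite -!piE scale1r. Qed.
Let scaleDr : right_distributive scale add.
Proof. by move=> a; do 2!elim/quotW=> ?; rewrite -!piE scalerDr. Qed.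
Let scaleDl x : {morph scale^~ x : a b / a + b >-> add a b}.
Proof. by elim/quotW: x => ? a b; rewrite -!piE scalerDl. Qed.

#[export]
HB.instance Definition _ :=
  GRing.Zmodule_isLmodule.Build K quot scaleA scale1 scaleDr scaleDl.

Let bracketPl (a : K) (x y z : quot) :
  bracket (add (scale a x) y) z = add (scale a (bracket x z)) (bracket y z).
Proof.
by move: x y z; do 3!elim/quotW=> ?; rewrite -!piE liePl.
Qed.
Let bracketPr (a : K) (x y z : quot) :
  bracket z (add (scale a x) y) = add (scale a (bracket z x)) (bracket z y).
Proof.
by move: x y z; do 3!elim/quotW=> ?; rewrite -!piE liePr.
Qed.
Let bracketvv x : bracket x x = \pi_quot 0.
Proof. by elim/quotW: x => ?; rewrite -!piE lievv. Qed.
Let bracket_jacobi x y z :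
  add (add (bracket x (bracket y z)) (bracket y (bracket z x)))
    (bracket z (bracket x y)) = \pi_quot 0.
Proof.
by move: x y z; do 3!elim/quotW=> ?; rewrite -!piE lie_jacobi.
Qed.

#[export]
HB.instance Definition _ := Lmodule_isLieAlgebra.Build K quot
  bracketPl bracketPr bracketvv bracket_jacobi.

End LieQuotient.
Module Exports. HB.reexport. End Exports.
End LieQuotient.
Export LieQuotient.Exports.

Notation lie_quot := LieQuotient.quot.

Definition lie_pi (K : fieldType) (L : lieAlgType K) (I : lieIdeal L) (u : L) :
  lie_quot I := \pi_(lie_quot I) u.

Section Morphisms.
Variables (K : fieldType).

Definition is_lie_hom (L M : lieAlgType K) (f : L -> M) :=
  [/\ forall a u, f (a *: u) = a *: f u,
      forall u v, f (u + v) = f u + f v &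
      forall u v, f [lie u, v] = [lie f u, f v]].

Definition is_lie_aut (L : lieAlgType K) (f : L -> L) :=
  is_lie_hom f /\ bijective f.

Definition is_normal_aut (L : lieAlgType K) (f : L -> L) :=
  is_lie_aut f /\ forall I : set L, is_ideal I -> f @` I = I.

Lemma lie_pi_hom (L : lieAlgType K) (I : lieIdeal L) : is_lie_hom (@lie_pi K L I).
Proof.
by split=> *; [exact: LieQuotient.pi_scale|exact: LieQuotient.pi_add
              |exact: LieQuotient.pi_bracket].
Qed.

Lemma lie_pi_eq (L : lieAlgType K) (I : lieIdeal L) (u v : L) :
  lie_pi I u = lie_pi I v <-> ideal_set I (u - v).
Proof. exact: LieQuotient.pi_eq. Qed.

Lemma lie_pi_surj (L : lieAlgType K) (I : lieIdeal L) (x : lie_quot I) :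
  exists u, x = lie_pi I u.
Proof. by exists (repr x); rewrite /lie_pi reprK. Qed.

Definition derived1_lieIdeal (L : lieAlgType K) : lieIdeal L :=
  LieIdeal (@derived1_ideal K L).

Definition is_IA_aut (L : lieAlgType K) (f : L -> L) :=
  is_lie_aut f /\
  forall u, lie_pi (derived1_lieIdeal L) (f u) = lie_pi (derived1_lieIdeal L) u.

End Morphisms.

Inductive lie_term (K : Type) (m : nat) :=
| LGen of 'I_m
| LZero
| LOpp of lie_term K m
| LAdd of lie_term K m & lie_term K m
| LScale of K & lie_term K m
| LLie of lie_term K m & lie_term K m.

Arguments LGen {K m} _.
Arguments LZero {K m}.

HB.instance Definition _ K m := gen_eqMixin (lie_term K m).
HB.instance Definition _ K m := gen_choiceMixin (lie_term K m).

Fixpoint lie_eval (K : fieldType) (m : nat) (M : lieAlgType K) (g : 'I_m -> M)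
    (t : lie_term K m) : M :=
  match t with
  | LGen i => g i
  | LZero => 0
  | LOpp t => - lie_eval g t
  | LAdd t s => lie_eval g t + lie_eval g s
  | LScale a t => a *: lie_eval g t
  | LLie t s => [lie lie_eval g t, lie_eval g s]
  end.

(* The free Lie algebra: formal Lie expressions in the generators, two of them
   being identified when they agree under every assignment of the generators
   in every Lie algebra over K. Its universal property is lemma free_lieP. *)
Module FreeLie.
Section FreeLie.
Variables (K : fieldType) (m : nat).
Notation term := (lie_term K m).

Definition equiv (t s : term) : bool :=
  `[< forall (M : lieAlgType K) (g : 'I_m -> M), lie_eval g t = lie_eval g s >].

Lemma equiv_is_equiv : equiv_class_of equiv.
Proof.
split=> [t|t s|s t r].
- exact/asboolP.
- by apply: asbool_equiv_eq; split=> ts M g; rewrite ts.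
- by move=> /asboolP ts /asboolP sr; apply/asboolP => M g; rewrite ts.
Qed.

Canonical equiv_equiv := EquivRelPack equiv_is_equiv.
Canonical equiv_encModRel := defaultEncModRel equiv.

Definition type := {eq_quot equiv}.
#[export]
HB.instance Definition _ : EqQuotient term equiv type := EqQuotient.on type.
#[export]
HB.instance Definition _ := Choice.on type.

Lemma pi_eq (t s : term) : \pi_type t = \pi_type s <->
  forall (M : lieAlgType K) (g : 'I_m -> M), lie_eval g t = lie_eval g s.
Proof.
by split=> [/eqP|/asboolP ts]; [rewrite piE => /asboolP|apply/eqP; rewrite piE].
Qed.

Lemma eval_repr (t : term) (M : lieAlgType K) (g : 'I_m -> M) :
  lie_eval g (repr (\pi_type t)) = lie_eval g t.
Proof. by move: M g; apply/pi_eq; rewrite reprK. Qed.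

Definition gen (i : 'I_m) : type := \pi_type (LGen i).
Definition zero : type := \pi_type LZero.
Definition opp := lift_op1 type (@LOpp K m).
Definition add := lift_op2 type (@LAdd K m).
Definition scale (a : K) := lift_op1 type (LScale a).
Definition bracket := lift_op2 type (@LLie K m).

Lemma pi_opp : {morph \pi_type : t / LOpp t >-> opp t}.
Proof. by move=> t; unlock opp; apply/pi_eq => M g /=; rewrite eval_repr. Qed.
Lemma pi_add : {morph \pi_type : t s / LAdd t s >-> add t s}.
Proof. by move=> t s; unlock add; apply/pi_eq => M g /=; rewrite !eval_repr. Qed.
Lemma pi_scale a : {morph \pi_type : t / LScale a t >-> scale a t}.
Proof. by move=> t; unlock scale; apply/pi_eq => M g /=; rewrite eval_repr. Qed.
Lemma pi_bracket : {morph \pi_type : t s / LLie t s >-> bracket t s}.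
Proof. by move=> t s; unlock bracket; apply/pi_eq => M g /=; rewrite !eval_repr. Qed.

Let piE := (pi_add, pi_opp, pi_scale, pi_bracket).
Let quotW (P : type -> Prop) : (forall t, P (\pi_type t)) -> forall x, P x.
Proof. by move=> Ppi x; rewrite -[x]reprK. Qed.

Let addA : associative add.
Proof. by do 3!elim/quotW=> ?; rewrite -!piE; apply/pi_eq => M g /=; rewrite addrA. Qed.
Let addC : commutative add.
Proof. by do 2!elim/quotW=> ?; rewrite -!piE; apply/pi_eq => M g /=; rewrite addrC. Qed.
Let add0 : left_id zero add.
Proof. by elim/quotW=> ?; rewrite -!piE; apply/pi_eq => M g /=; rewrite add0r. Qed.
Let addN : left_inverse zero opp add.
Proof. by elim/quotW=> ?; rewrite -!piE; apply/pi_eq => M g /=; rewrite addNr. Qed.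

#[export]
HB.instance Definition _ := GRing.isZmodule.Build type addA addC add0 addN.

Let scaleA a b x : scale a (scale b x) = scale (a * b) x.
Proof. by elim/quotW: x => ?; rewrite -!piE; apply/pi_eq => M g /=; rewrite scalerA. Qed.
Let scale1 : left_id 1 scale.
Proof. by elim/quotW=> ?; rewrite -!piE; apply/pi_eq => M g /=; rewrite scale1r. Qed.
Let scaleDr : right_distributive scale add.
Proof.
by move=> a; do 2!elim/quotW=> ?; rewrite -!piE; apply/pi_eq => M g /=; rewrite scalerDr.
Qed.
Let scaleDl x : {morph scale^~ x : a b / a + b >-> add a b}.
Proof.
by elim/quotW: x => ? a b; rewrite -!piE; apply/pi_eq => M g /=; rewrite scalerDl.
Qed.

#[export]
HB.instance Definition _ :=
  GRing.Zmodule_isLmodule.Build K type scaleA scale1 scaleDr scaleDl.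

Let bracketPl (a : K) (x y z : type) :
  bracket (add (scale a x) y) z = add (scale a (bracket x z)) (bracket y z).
Proof.
move: x y z; do 3!elim/quotW=> ?; rewrite -!piE.
by apply/pi_eq => M g /=; rewrite liePl.
Qed.
Let bracketPr (a : K) (x y z : type) :
  bracket z (add (scale a x) y) = add (scale a (bracket z x)) (bracket z y).
Proof.
move: x y z; do 3!elim/quotW=> ?; rewrite -!piE.
by apply/pi_eq => M g /=; rewrite liePr.
Qed.
Let bracketvv x : bracket x x = zero.
Proof. by elim/quotW: x => ?; rewrite -!piE; apply/pi_eq => M g /=; rewrite lievv. Qed.
Let bracket_jacobi x y z :
  add (add (bracket x (bracket y z)) (bracket y (bracket z x)))
    (bracket z (bracket x y)) = zero.
Proof.
move: x y z; do 3!elim/quotW=> ?; rewrite -!piE.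
by apply/pi_eq => M g /=; rewrite lie_jacobi.
Qed.

#[export]
HB.instance Definition _ := Lmodule_isLieAlgebra.Build K type
  bracketPl bracketPr bracketvv bracket_jacobi.

Definition lift (M : lieAlgType K) (g : 'I_m -> M) (x : type) : M :=
  lie_eval g (repr x).

Lemma lift_hom (M : lieAlgType K) (g : 'I_m -> M) : is_lie_hom (lift g).
Proof.
rewrite /lift; split.
- by move=> a; elim/quotW=> t; rewrite -[a *: _]pi_scale !eval_repr.
- by do 2!elim/quotW=> ?; rewrite -[_ + _]pi_add !eval_repr.
- by do 2!elim/quotW=> ?; rewrite -[[lie _, _]]pi_bracket !eval_repr.
Qed.

Lemma lift_gen (M : lieAlgType K) (g : 'I_m -> M) i : lift g (gen i) = g i.
Proof. by rewrite /lift eval_repr. Qed.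

Lemma lift_unique (M : lieAlgType K) (g : 'I_m -> M) (f : type -> M) :
  is_lie_hom f -> (forall i, f (gen i) = g i) -> f =1 lift g.
Proof.
move=> [fZ fD fL] fg; have f0 : f 0 = 0 by rewrite -[in LHS](scale0r (0 : type)) fZ scale0r.
elim/quotW=> t; rewrite /lift eval_repr; elim: t => /=.
- exact: fg.
- exact: f0.
- move=> t <-; rewrite pi_opp -[opp _]/(- \pi_type t).
  by rewrite -scaleN1r fZ scaleN1r.
- by move=> t <- s <-; rewrite -fD -[_ + _]pi_add.
- by move=> a t <-; rewrite -fZ -[_ *: _]pi_scale.
- by move=> t <- s <-; rewrite -fL -[[lie _, _]]pi_bracket.
Qed.

End FreeLie.
Module Exports. HB.reexport. End Exports.
End FreeLie.
Export FreeLie.Exports.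

Notation free_lie := FreeLie.type.
Notation free_gen := FreeLie.gen.

Lemma free_lieP (K : fieldType) (m : nat) (M : lieAlgType K) (g : 'I_m -> M) :
  exists2 f : free_lie K m -> M, is_lie_hom f /\ (forall i, f (free_gen K i) = g i) &
    forall h, is_lie_hom h -> (forall i, h (free_gen K i) = g i) -> h =1 f.
Proof.
exists (FreeLie.lift g); last exact: FreeLie.lift_unique.
by split; [exact: FreeLie.lift_hom|exact: FreeLie.lift_gen].
Qed.

Section FreeMetabelianNilpotent.
Variables (K : fieldType) (m c : nat).

Definition metanil_ideal : lieIdeal (free_lie K m) :=
  LieIdeal (set_add_ideal (@derived2_ideal K (free_lie K m))
                          (lower_central_ideal (free_lie K m) c.+1)).

Definition free_metanil := lie_quot metanil_ideal.
HB.instance Definition _ := LieAlgebra.on free_metanil.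

Definition metanil_gen (i : 'I_m) : free_metanil := lie_pi metanil_ideal (free_gen K i).

End FreeMetabelianNilpotent.

Section GeneralizedInner.
Variables (K : fieldType) (m : nat) (L : lieAlgType K) (x : 'I_m -> L).

Definition ad (v u : L) : L := [lie u, v].

(* u acted on by the monomial (ad x_0)^(e 0) (ad x_1)^(e 1) ..., the operator
   ad x_0 being applied first; on L' the order is irrelevant as soon as L is
   metabelian. *)
Definition ad_monom (u : L) (e : 'X_{1..m}) : L :=
  foldl (fun w i => iter (e i) (ad (x i)) w) u (enum 'I_m).

Definition ad_poly (u : L) (f : {mpoly K[m]}) : L :=
  \sum_(e <- msupp f) f@_e *: ad_monom u e.

End GeneralizedInner.

Definition is_generalized_inner (K : fieldType) (m c : nat)
    (f : free_metanil K m c -> free_metanil K m c) :=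
  let x := @metanil_gen K m c in
  is_lie_aut f /\
  exists p : 'I_m -> {mpoly K[m]},
    forall i, f (x i) = x i + \sum_(j < m) ad_poly x [lie x i, x j] (p j).

(* Main.v *)
Require Import Defs.
From HB Require Import structures.
From mathcomp Require Import all_boot all_order all_algebra.
From mathcomp Require Import ssrcomplements mpoly boolp classical_sets.

(** Write phi x_i = x_i + u_i. The ideal generated by x_i is spanned by x_i and
the elements [x_i, x_j] f with f a polynomial in the operators ad x_1, ...,
ad x_m (lemma gen_ideal_form), so a normal IA-automorphism satisfies
phi x_i = x_i + sum_j [x_i, x_j] f_ij (lemma normal_IA_form). What has to be
shown is that f_ij may be chosen independently of i.

Only the part of f_ij of degree at most c - 2 matters, since [x_i, x_j] lies in
the second term of the lower central series and each ad x_k moves one term down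
(lemma eq_ad_poly_low). In these degrees f_il = f_kl for all i, k different
from l (lemma normal_coef_indep), because phi preserves kernels of
homomorphisms: for scalars s_1, ..., s_m, let K z act on N = K[t]/(t^c) with z
acting as t, and map L_{m,c} to the semidirect product of K z and N by
x_l |-> s_l z + 1 and x_j |-> s_j z for j <> l. The combination
v = s_k x_i - s_i x_k goes to 0, hence so does phi v. But the image of
[x_i, x_l] f is - s_i t f(s_1 t, ..., s_m t), and the images of the brackets
[x_i, x_j] and [x_k, x_j] with j <> l vanish, so that
s_i s_k t (f_il - f_kl)(s t) = 0 modulo t^c. If no s_j is zero, every
homogeneous component of f_il - f_kl of degree at most c - 2 vanishes at s; as K
is infinite, these components are zero (lemma torus_meval_eq0).

As m >= 2, each j admits some i <> j, and f_ij for such an i is the common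
f_j; for i = j nothing is to be compared, since [x_j, x_j] = 0. *)

Set Implicit Arguments.
Unset Strict Implicit.
Unset Printing Implicit Defensive.

Import GRing.Theory.

(** * Polynomials vanishing on the torus *)

Section Torus.
Local Open Scope ring_scope.

Lemma radix_inj (B n : nat) (d e : 'I_n -> nat) :
    (forall j, d j < B)%N -> (forall j, e j < B)%N ->
    (\sum_j d j * B ^ j = \sum_j e j * B ^ j)%N -> d =1 e.
Proof.
elim: n d e => [|n IH] d e dB eB; first by move=> _ [].
rewrite !big_ord_recl !expn0 !muln1.
have shift (f : 'I_n.+1 -> nat) : (\sum_(j < n) f (lift ord0 j) * B ^ lift ord0 j =
    (\sum_(j < n) f (lift ord0 j) * B ^ j) * B)%N.
  by rewrite big_distrl; apply: eq_bigr => j _; rewrite /= /bump add1n expnSr mulnA.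
have B0 : (0 < B)%N by apply: leq_ltn_trans (dB ord0).
rewrite !shift ![(_ ord0 + _)%N]addnC => E.
have E0 : d ord0 = e ord0.
  by have /(congr1 (modn^~ B)) := E; rewrite !modnMDl !modn_small.
have /(congr1 (divn^~ B)) := E; rewrite !divnMDl // !divn_small // !addn0.
move=> /(IH (fun j => d (lift ord0 j)) (fun j => e (lift ord0 j))) H j.
by case: (unliftP ord0 j) => [i ->|->] //; apply: H.
Qed.

Lemma pchar0_natr_inj (K : fieldType) : [pchar K] =i pred0 ->
  injective (fun n => n%:R : K).
Proof.
move=> charK.
suff W i j : (i <= j)%N -> i%:R = j%:R :> K -> i = j.
  by move=> i j E; case: (leqP i j) => [|/ltnW] /W; [apply|move=> <-].
move=> ij /esym/eqP; rewrite -subr_eq0 -natrB // (pcharf0P K).1 // subn_eq0 => ji.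
by apply/eqP; rewrite eqn_leq ij.
Qed.

(** The substitution of y^(B^j) for the j-th variable, with B larger than every
exponent, sends distinct monomials to distinct powers of y (Kronecker), which
reduces the claim to a univariate polynomial with the roots 1, 2, 3, and so
on. *)
Lemma torus_meval_eq0 (K : fieldType) (n : nat) (p : {mpoly K[n]}) :
    [pchar K] =i pred0 ->
    (forall s : 'I_n -> K, (forall j, s j != 0) -> p.@[s] = 0) -> p = 0.
Proof.
move=> charK p0; have natr_inj := pchar0_natr_inj charK.
pose B := msize p; pose k (e : 'X_{1..n}) := (\sum_j e j * B ^ j)%N.
have ltB e j : e \in msupp p -> (e j < B)%N.
  move=> /msize_mdeg_lt; apply: leq_ltn_trans; rewrite mdegE.
  by rewrite (bigD1 j) //= leq_addr.
pose r : {poly K} := \sum_(e <- msupp p) p@_e *: 'X^(k e).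
have r0 : r = 0.
  apply/eqP/negP => /negP rn0.
  have := @max_poly_roots _ r [seq i.+1%:R | i <- iota 0 (size r)] rn0.
  rewrite size_map size_iota ltnn => H; suff: false by []; apply: H; last first.
    by rewrite map_inj_uniq ?iota_uniq // => i j /natr_inj [].
  apply/allP => _ /mapP [i _ ->]; rewrite /root; apply/eqP.
  have -> : r.[i.+1%:R] = p.@[fun j => i.+1%:R ^+ (B ^ j)].
    rewrite mevalE horner_sum; apply: eq_bigr => e _.
    rewrite hornerZ hornerXn -prodrXr; congr (_ * _); apply: eq_bigr => j _.
    by rewrite -exprM mulnC.
  apply: p0 => j; rewrite expf_eq0 negb_and; apply/orP; right.
  by rewrite (pcharf0P K).1.
apply/mpolyP => e; rewrite mcoeff0; have [ep|/memN_msupp_eq0 //] := boolP (e \in msupp p).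
have := congr1 (fun q : {poly K} => q`_(k e)) r0; rewrite coef0 /r coef_sum.
rewrite (bigD1_seq e) ?msupp_uniq //= big_seq_cond big1 ?addr0.
  by rewrite coefZ coefXn eqxx mulr1.
move=> d /andP [dp de]; rewrite coefZ coefXn; case: eqP => [E|]; last by rewrite mulr0.
case/eqP: de; apply/mnmP => j; symmetry; move: j; apply: (@radix_inj B) => // j; exact: ltB.
Qed.
End Torus.

(** * Lie homomorphisms and the derived and lower central series *)

Section LieHom.
Local Open Scope ring_scope.
Local Open Scope classical_set_scope.
Variables (K : fieldType) (L M : lieAlgType K) (f : L -> M).
Hypothesis f_hom : is_lie_hom f.
Implicit Types (A B : set L).

Lemma lie_homP a u v : f (a *: u + v) = a *: f u + f v.
Proof. by case: f_hom => fZ fD _; rewrite fD fZ. Qed.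

Lemma lie_hom0 : f 0 = 0.
Proof. by have := lie_homP (-1) 0 0; rewrite scaleN1r oppr0 add0r scaleN1r addNr. Qed.

Lemma lie_hom_sum (I : Type) (r : seq I) (F : I -> L) :
  f (\sum_(i <- r) F i) = \sum_(i <- r) f (F i).
Proof. by case: f_hom => _ fD _; apply: (big_morph f fD lie_hom0). Qed.

Lemma preimage_subspace (C : set M) : is_subspace C -> is_subspace (f @^-1` C).
Proof.
by move=> [C0 CP]; split=> [|a u v Cu Cv]; rewrite /preimage /= ?lie_hom0 ?lie_homP //; apply: CP.
Qed.

Lemma preimage_ideal (C : set M) : is_ideal C -> is_ideal (f @^-1` C).
Proof.
case: f_hom => _ _ fL [/preimage_subspace ? CL]; split=> // u v Cu.
by rewrite /preimage /= fL; apply: CL.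
Qed.

Lemma lie_hom_lie_prod A B (C D : set M) :
  A `<=` f @^-1` C -> B `<=` f @^-1` D -> lie_prod A B `<=` f @^-1` lie_prod C D.
Proof.
case: f_hom => _ _ fL AC BD; apply: lie_prod_sub.
  by apply: preimage_subspace; apply: smallest_subspace.
by move=> u v Au Bv; rewrite /preimage /= fL; apply: lie_prod_in; [apply: AC|apply: BD].
Qed.

Lemma lie_hom_derived2 : derived2 L `<=` f @^-1` derived2 M.
Proof. by do 2!apply: lie_hom_lie_prod. Qed.

Lemma lie_hom_lower_central k : lower_central L k `<=` f @^-1` lower_central M k.
Proof.
by rewrite /lower_central; elim: k.-1 => //= n IH; apply: lie_hom_lie_prod.
Qed.

Lemma image_subspace A : is_subspace A -> is_subspace (f @` A).
Proof.
move=> [A0 AP]; split; first by exists 0 => //; apply: lie_hom0.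
move=> a _ _ [u Au <-] [v Av <-]; exists (a *: u + v); last exact: lie_homP.
exact: AP.
Qed.

Lemma lie_prod_image A B : lie_prod (f @` A) (f @` B) `<=` f @` lie_prod A B.
Proof.
case: f_hom => _ _ fL; apply: lie_prod_sub.
  by apply: image_subspace; apply: smallest_subspace.
move=> _ _ [u Au <-] [v Bv <-]; exists [lie u, v]; last exact: fL.
exact: lie_prod_in.
Qed.

End LieHom.

Section Lie.
Local Open Scope ring_scope.
Local Open Scope classical_set_scope.
Variables (K : fieldType).

Lemma lie_prodS (L : lieAlgType K) (A B C D : set L) :
  A `<=` C -> B `<=` D -> lie_prod A B `<=` lie_prod C D.
Proof.
move=> AC BD; apply: lie_prod_sub; first exact: smallest_subspace.
by move=> u v Au Bv; apply: lie_prod_in; [apply: AC|apply: BD].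
Qed.

Lemma image_derived2 (L M : lieAlgType K) (f : L -> M) :
  is_lie_hom f -> f @` setT = setT -> derived2 M `<=` f @` derived2 L.
Proof.
move=> fh fT; have d1 : derived1 M `<=` f @` derived1 L.
  by rewrite /derived1 -fT; apply: lie_prod_image.
by move=> y /(lie_prodS d1 d1); apply: lie_prod_image.
Qed.

Lemma image_lower_central (L M : lieAlgType K) (f : L -> M) k :
  is_lie_hom f -> f @` setT = setT -> lower_central M k `<=` f @` lower_central L k.
Proof.
move=> fh fT; rewrite /lower_central; elim: k.-1 => [|n IH] /=; first by rewrite fT.
by rewrite -[X in lie_prod _ X]fT => y /(lie_prodS IH (@subset_refl _ _)); apply: lie_prod_image.
Qed.

Lemma lie_derived1 (L : lieAlgType K) (u v : L) : derived1 L [lie u, v].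
Proof. exact: (lie_prod_in (A := setT) (B := setT)). Qed.

Lemma lie_lower_central (L : lieAlgType K) (k : nat) (u v : L) :
  lower_central L k u -> lower_central L k.+1 [lie u, v].
Proof. by case: k => [|k] // uk; apply: (lie_prod_in (B := setT)). Qed.

Lemma lower_central_le (L : lieAlgType K) (j k : nat) :
  (j <= k)%N -> lower_central L k `<=` lower_central L j.
Proof.
move=> /subnKC <-; elim: (k - j)%N => [|n IH] u; rewrite ?addn0 // addnS => un.
apply: IH; case: (j + n)%N un => // {}n.
apply: (lie_prod_sub (lower_central_ideal L n.+1).1) => v w vn _.
exact: (lower_central_ideal L n.+1).2.
Qed.

Lemma is_ideal0 (L : lieAlgType K) : is_ideal [set 0 : L].
Proof.
split; first split=> // a _ _ -> ->; first by rewrite /set1 /= scaler0 addr0.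
by move=> _ v ->; rewrite /set1 /= lie0l.
Qed.

End Lie.

(** * The free metabelian nilpotent Lie algebra *)

Section FreeMetanil.
Local Open Scope ring_scope.
Local Open Scope classical_set_scope.
Variables (K : fieldType) (m c : nat).
Notation L := (free_metanil K m c).
Notation x := (@metanil_gen K m c).
Notation I := (metanil_ideal K m c).

Lemma lie_pi_setT : @lie_pi K _ I @` setT = setT.
Proof. by apply/seteqP; split=> // y _; have [u ->] := lie_pi_surj y; exists u. Qed.

Lemma lie_pi_eq0 u : ideal_set I u -> lie_pi I u = 0 :> L.
Proof.
move=> Iu; rewrite -(lie_hom0 (lie_pi_hom I)).
by apply/lie_pi_eq; rewrite subr0.
Qed.

Lemma metanil_derived2 : derived2 L `<=` [set 0].
Proof.
move=> _ /(image_derived2 (lie_pi_hom I) lie_pi_setT) [u u2 <-].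
apply: lie_pi_eq0; exists u => //; exists 0; last by rewrite addr0.
by case: (@lower_central_ideal _ (free_lie K m) c.+1) => -[].
Qed.

Lemma metanil_lower_central : lower_central L c.+1 `<=` [set 0].
Proof.
move=> _ /(image_lower_central (lie_pi_hom I) lie_pi_setT) [u uc <-].
apply: lie_pi_eq0; exists 0; last by exists u => //; rewrite add0r.
by case: (@derived2_ideal _ (free_lie K m)) => -[].
Qed.

Lemma metanil_lift (M : lieAlgType K) (g : 'I_m -> M) :
    derived2 M `<=` [set 0] -> lower_central M c.+1 `<=` [set 0] ->
  exists2 h : L -> M, is_lie_hom h & forall i, h (x i) = g i.
Proof.
move=> M2 Mc; have fh := FreeLie.lift_hom g; set f := FreeLie.lift g in fh.
have fI u : ideal_set I u -> f u = 0.
  move=> [v v2 [w wc <-]]; case: (fh) => _ -> _.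
  have /M2 -> := lie_hom_derived2 fh v2.
  by have /Mc -> := lie_hom_lower_central fh wc; rewrite addr0.
have [h hE] : exists h : L -> M, forall u, h (lie_pi I u) = f u.
  exists (fun y => f (repr y)) => u.
  have /lie_pi_eq/fI : lie_pi I (repr (lie_pi I u)) = lie_pi I u by rewrite /lie_pi reprK.
  rewrite addrC -scaleN1r (lie_homP fh) scaleN1r => /eqP.
  by rewrite addrC subr_eq0 => /eqP.
exists h; last by move=> i; rewrite hE [f _]FreeLie.lift_gen.
have [pZ pD pL] := lie_pi_hom I; case: (fh) => fZ fD fL; split.
- by move=> a y; have [u ->] := lie_pi_surj y; rewrite -pZ !hE.
- move=> y z; have [u ->] := lie_pi_surj y; have [v ->] := lie_pi_surj z.
  by rewrite -pD !hE.
- move=> y z; have [u ->] := lie_pi_surj y; have [v ->] := lie_pi_surj z.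
  by rewrite -pL !hE.
Qed.

Lemma metanil_gen_ind (A : set L) :
    is_subspace A -> (forall u v, A u -> A v -> A [lie u, v]) ->
  (forall i, A (x i)) -> forall u, A u.
Proof.
move=> [A0 AP] AL Ax y; have [u ->] := lie_pi_surj y.
rewrite (FreeLie.lift_unique (lie_pi_hom I) (g := x)) // /FreeLie.lift.
elim: (repr u) => /=.
- exact: Ax.
- exact: A0.
- by move=> t At; rewrite -scaleN1r -[_ *: _]addr0; apply: AP.
- by move=> t At s As; rewrite -[X in X + _]scale1r; apply: AP.
- by move=> a t At; rewrite -[_ *: _]addr0; apply: AP.
- by move=> t At s As; apply: AL.
Qed.

(** The elements that bracket A into itself form a subalgebra, by the Jacobi
identity, so the generators suffice to test that A is an ideal. *)
Lemma metanil_ideal_gen (A : set L) :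
  is_subspace A -> (forall u i, A u -> A [lie u, x i]) -> is_ideal A.
Proof.
move=> AS Ax; split=> // u v Au; move: v u Au.
apply: (@metanil_gen_ind (fun v => forall u, A u -> A [lie u, v])).
- case: AS => A0 AP; split=> [u _|a v w Av Aw u Au]; first by rewrite lie0r.
  by rewrite liePr; apply: AP; [apply: Av|apply: Aw].
- move=> v w Av Aw u Au.
  have -> : [lie u, [lie v, w]] = -1 *: [lie [lie u, w], v] + [lie [lie u, v], w].
    by rewrite scaleN1r -lieC lieA addrC subrK.
  by apply: AS.2; [apply/Av/Aw|apply/Aw/Av].
- by move=> i u; apply: Ax.
Qed.

End FreeMetanil.

(** * Polynomials in the operators ad x_i *)

Section AdPoly.
Local Open Scope ring_scope.
Local Open Scope classical_set_scope.
Variables (K : fieldType) (m : nat) (L : lieAlgType K) (x : 'I_m -> L).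
Implicit Types (u v w : L) (e : 'X_{1..m}) (f g : {mpoly K[m]}).

Lemma ad_polywE (k : nat) u f : (msize f <= k)%N ->
  ad_poly x u f = \sum_(e : 'X_{1..m < k}) f@_e *: ad_monom x u e.
Proof.
move=> fk; rewrite /ad_poly (big_mksub 'X_{1..m < k}) //=; last first.
- by move=> e /msize_mdeg_lt/leq_trans; apply.
- exact: msupp_uniq.
by rewrite big_rmcond //= => e /memN_msupp_eq0 ->; rewrite scale0r.
Qed.

Lemma ad_polyP u a f g : ad_poly x u (a *: f + g) = a *: ad_poly x u f + ad_poly x u g.
Proof.
pose k := maxn (msize (a *: f + g)) (maxn (msize f) (msize g)).
rewrite !(@ad_polywE k) ?leq_max ?leqnn ?orbT // scaler_sumr -big_split.
by apply: eq_bigr => e _; rewrite mcoeffD mcoeffZ scalerDl scalerA.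
Qed.

Lemma ad_poly0r u : ad_poly x u 0 = 0.
Proof. by rewrite /ad_poly msupp0 big_nil. Qed.

Lemma ad_polyC u a : ad_poly x u a%:MP = a *: u.
Proof.
have ad1 : ad_monom x u 0%MM = u.
  by rewrite /ad_monom; elim: (enum 'I_m) => //= i s IH; rewrite mnm0E.
rewrite /ad_poly msuppC; have [->|_] := eqVneq a 0; first by rewrite big_nil scale0r.
by rewrite big_seq1 mcoeffC eqxx mulr1 ad1.
Qed.

Lemma ad_monom_ideal (I : set L) u e : is_ideal I -> I u -> I (ad_monom x u e).
Proof.
move=> [_ IL]; rewrite /ad_monom; elim: (enum 'I_m) u => //= i s IH u Iu; apply: IH.
by elim: (e i) => //= n; apply: IL.
Qed.

Lemma ad_poly_ideal (I : set L) u f : is_ideal I -> I u -> I (ad_poly x u f).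
Proof.
move=> II Iu; have [[I0 IP] _] := II; rewrite /ad_poly.
elim/big_rec: _ => // e w _ Iw; apply: IP => //; exact: ad_monom_ideal.
Qed.

Lemma ad_poly0l f : ad_poly x 0 f = 0.
Proof. exact: (ad_poly_ideal f (is_ideal0 L)). Qed.

Lemma ad_monom_lower_central k u e : lower_central L k u ->
  lower_central L (k + mdeg e) (ad_monom x u e).
Proof.
have iterS n v w j : lower_central L j w -> lower_central L (j + n) (iter n (ad v) w).
  by elim: n => [|n IH] jw; rewrite ?addn0 // addnS; apply/lie_lower_central/IH.
rewrite mdegE /ad_monom -[X in _ -> lower_central L (k + X) _]big_enum /=.
elim: (enum 'I_m) k u => [|i s IH] k u ku /=; first by rewrite big_nil addn0.
by rewrite big_cons addnA; apply/IH/iterS.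
Qed.

Lemma lie_hom_ad_poly (M : lieAlgType K) (h : L -> M) : is_lie_hom h ->
  forall u f, h (ad_poly x u f) = ad_poly (h \o x) (h u) f.
Proof.
move=> hh u f; case: (hh) => hZ hD hL.
rewrite /ad_poly (lie_hom_sum hh); apply: eq_bigr => e _; rewrite hZ; congr (_ *: _).
rewrite /ad_monom; elim: (enum 'I_m) u => //= i s IH u; rewrite IH; congr foldl.
by elim: (e i) => //= n IHn; rewrite /ad hL -IHn.
Qed.

Hypothesis metabelian : derived2 L `<=` [set 0].

(** By the Jacobi identity [[u, v], w] - [[u, w], v] is [u, [v, w]], which lies in
the second derived algebra. *)
Lemma metabelian_adC u v w : derived1 L u -> [lie [lie u, v], w] = [lie [lie u, w], v].
Proof.
move=> u1; have /metabelian uvw : derived2 L [lie u, [lie v, w]].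
  by apply: lie_prod_in => //; apply: lie_derived1.
by rewrite lieA [X in X - _]uvw sub0r -lieC.
Qed.

(** The operator ad x_k, applied last, moves past the operators ad x_i with i > k
to its place in the increasing product that defines ad_monom. *)
Lemma ad_monom_mulU u e k : derived1 L u ->
  [lie ad_monom x u e, x k] = ad_monom x u (e + U_(k))%MM.
Proof.
have iter1 n v w : derived1 L w -> derived1 L (iter n (ad v) w).
  by move=> w1; elim: n => //= n; apply: (derived1_ideal L).2.
have iterC n v v' w : derived1 L w ->
    [lie iter n (ad v) w, v'] = iter n (ad v) [lie w, v'].
  by move=> w1; elim: n => //= n IH; rewrite [LHS](metabelian_adC _ _ (iter1 n v w w1)) IH.
have: k \in enum 'I_m by rewrite mem_enum.
rewrite /ad_monom; elim: (enum 'I_m) (enum_uniq 'I_m) u => //= i s IH /andP [is_ us] u.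
rewrite inE => /orP [/eqP Eki|ks] u1.
  subst i; rewrite mnmDE mnm1E eqxx addn1 /=.
  have -> w : foldl (fun w i => iter ((e + U_(k))%MM i) (ad (x i)) w) w s =
      foldl (fun w i => iter (e i) (ad (x i)) w) w s.
    elim: s is_ w {IH us} => //= i s IH; rewrite inE negb_or => /andP [ki /IH E] w.
    by rewrite mnmDE mnm1E (negbTE ki) addn0.
  rewrite -[ad _ _]/([lie _, x k]).
  have := iter1 (e k) (x k) u u1; move: (iter _ _ u) => {}u {}u1.
  elim: s u u1 {is_ us IH} => //= i s IH u u1.
  by rewrite IH ?iterC //; apply: iter1.
rewrite IH //; last exact: iter1.
rewrite mnmDE mnm1E; case: eqP is_ => [<-|_ _]; first by rewrite ks.
by rewrite addn0.
Qed.

Lemma ad_poly_mulX u f k : derived1 L u ->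
  [lie ad_poly x u f, x k] = ad_poly x u (f * 'X_k).
Proof.
move=> u1; rewrite /ad_poly [RHS](perm_big _ (msuppMX _ _)) [RHS]big_map.
rewrite (big_morph (fun w => [lie w, x k]) (fun v w => lieDl v w (x k)) (lie0l (x k))).
by apply: eq_bigr => e _; rewrite lieZl ad_monom_mulU // mpoly.addmC mcoeffMX.
Qed.

End AdPoly.

(** * Extension of a module by one operator *)

Section ShiftExt.
Local Open Scope ring_scope.
Local Open Scope classical_set_scope.
Variable (K : fieldType).

(** The semidirect product of a one-dimensional Lie algebra with the abelian Lie
algebra N, on which it acts through z: the pair (a, n) stands for a z + n. The
endomorphism z occurs only as a parameter of the type, so that the bracket,
which depends on z, can be attached to it as a structure. *)
Definition shift_ext (N : lmodType K) (z : {linear N -> N}) : Type := (K^o * N)%type.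

Section Structure.
Variables (N : lmodType K) (z : {linear N -> N}).
Notation T := (shift_ext z).

HB.instance Definition _ := GRing.Lmodule.copy T (K^o * N)%type.

Definition shift_lie (u v : T) : T := (0, z (v.1 *: u.2 - u.1 *: v.2)).

Let shift_liePl a (u v w : T) :
  shift_lie (a *: u + v) w = a *: shift_lie u w + shift_lie v w.
Proof.
apply/eqP; rewrite xpair_eqE /= scaler0 addr0 eqxx -(linearP z); apply/eqP; congr (z _).
by rewrite !scalerDr scalerDl opprD addrACA !scalerN !scalerA mulrC.
Qed.

Let shift_lievv (u : T) : shift_lie u u = 0.
Proof. by rewrite /shift_lie subrr linear0. Qed.

Let shift_lieC (u v : T) : shift_lie u v = - shift_lie v u.
Proof. by apply/eqP; rewrite xpair_eqE /= oppr0 eqxx -(linearN z) opprB /= eqxx. Qed.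

Let shift_liePr a (u v w : T) :
  shift_lie w (a *: u + v) = a *: shift_lie w u + shift_lie w v.
Proof.
by rewrite shift_lieC shift_liePl opprD -scalerN -!shift_lieC.
Qed.

Let shift_jacobi (u v w : T) :
  shift_lie u (shift_lie v w) + shift_lie v (shift_lie w u)
    + shift_lie w (shift_lie u v) = 0.
Proof.
apply/eqP; rewrite xpair_eqE /= !addr0 eqxx /= -!(linearD z).
rewrite !scale0r !sub0r -!(linearZZ z) -!(linearN z) -!(linearD z) !scalerBr !scalerA.
rewrite (mulrC v.1 w.1) (mulrC w.1 u.1) (mulrC u.1 v.1).
set a := _ *: u.2; set b := _ *: v.2; set d := _ *: w.2.
by rewrite -!opprD !subrKA subrr oppr0 !linear0.
Qed.

HB.instance Definition _ := Lmodule_isLieAlgebra.Build K T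
  shift_liePl shift_liePr shift_lievv shift_jacobi.

Lemma shift_lieE (u v : T) : [lie u, v] = (0, z (v.1 *: u.2 - u.1 *: v.2)) :> T.
Proof. by []. Qed.

Lemma iter_linearP n a (p q : N) : iter n z (a *: p + q) = a *: iter n z p + iter n z q.
Proof. by elim: n => //= n ->; rewrite linearP. Qed.

Lemma iter_linear0 n : iter n z 0 = 0.
Proof. by elim: n => //= n ->; rewrite linear0. Qed.

Lemma iter_linearZ n a (p : N) : iter n z (a *: p) = a *: iter n z p.
Proof. by rewrite -[a *: p]addr0 iter_linearP iter_linear0 addr0. Qed.

Lemma shift_ext_derived1 : derived1 T `<=` [set u | u.1 = 0].
Proof.
apply: lie_prod_sub => //; split=> // a u v /= -> ->.
by rewrite scaler0 addr0.
Qed.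

Lemma shift_ext_derived2 : derived2 T `<=` [set 0].
Proof.
apply: lie_prod_sub; first by split=> // a _ _ -> ->; rewrite /set1 /= scaler0 addr0.
move=> u v /shift_ext_derived1 /= u0 /shift_ext_derived1 /= v0.
by rewrite /set1 /= shift_lieE u0 v0 !scale0r subrr linear0.
Qed.

Lemma shift_ext_lower_central k :
  lower_central T k.+2 `<=` [set u | u.1 = 0 /\ exists n, u.2 = iter k.+1 z n].
Proof.
have subs j : is_subspace [set u : T | u.1 = 0 /\ exists n, u.2 = iter j z n].
  split=> [|a u v /= [-> [p ->]] [-> [q ->]]]; first by split=> //; exists 0; rewrite iter_linear0.
  by split; [rewrite scaler0 addr0|exists (a *: p + q); rewrite iter_linearP].
elim: k => [|k IH]; apply: lie_prod_sub => // u v.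
  by move=> _ _; rewrite shift_lieE; split=> //; eexists.
move=> /IH [u1 [n u2]] _; rewrite shift_lieE; split=> //=; exists (v.1 *: n).
by rewrite u1 u2 scale0r subr0 -(iter_linearZ k.+1).
Qed.

(** On N the generator x_i acts as s_i z, where s_i is its first component, so a
polynomial f acts as f(s_1 z, ..., s_m z). *)
Lemma shift_ext_ad_poly (m : nat) (x : 'I_m -> T) (n : N) (f : {mpoly K[m]}) :
  ad_poly x ((0, n) : T) f =
  (0, \sum_(e <- msupp f) (f@_e * \prod_i (x i).1 ^+ e i) *: iter (mdeg e) z n) :> T.
Proof.
have ad_iter i (p : N) k :
    iter k (ad (x i)) (0, p) = (0, (x i).1 ^+ k *: iter k z p) :> T.
  elim: k => [|k IH]; first by rewrite expr0 scale1r.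
  by rewrite iterS IH /ad shift_lieE /= scale0r subr0 scalerA -exprS linearZ.
have ad_monomE e : ad_monom x ((0, n) : T) e =
    (0, (\prod_i (x i).1 ^+ e i) *: iter (mdeg e) z n) :> T.
  rewrite mdegE /ad_monom -!big_enum /=.
  elim: (enum 'I_m) n => [|i s IH] p /=; first by rewrite !big_nil scale1r.
  rewrite ad_iter IH !big_cons; congr pair.
  rewrite iter_linearZ scalerA mulrC.
  by rewrite [(e i + _)%N]addnC iterD.
rewrite /ad_poly (eq_bigr _ (fun e _ => congr1 _ (ad_monomE e))).
elim: (msupp f) => [|e s IH]; first by rewrite !big_nil.
by rewrite !big_cons IH; congr pair; rewrite /= ?scaler0 ?addr0 ?scalerA.
Qed.

End Structure.

(** Multiplication by t on K[t]/(t^c), the quotient being represented by the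
truncated polynomials inside K[t]. *)
Definition trunc_shift (c : nat) (p : {poly K}) : {poly K} := take_poly c ('X * p).

Lemma trunc_shift_linear c : linear (trunc_shift c).
Proof. by move=> a p q; rewrite /trunc_shift mulrDr -scalerAr linearP. Qed.

HB.instance Definition _ c :=
  GRing.isLinear.Build K {poly K} {poly K} _ (trunc_shift c) (@trunc_shift_linear c).

Lemma coef_iter_trunc_shift c k p d : (d < c)%N ->
  (iter k (trunc_shift c) p)`_d = if (d < k)%N then 0 else p`_(d - k).
Proof.
elim: k d => [|k IH] d dc; first by rewrite subn0.
rewrite iterS /trunc_shift coef_take_poly dc coefXM.
by case: d dc => [|d] // dc; rewrite IH // ltnW.
Qed.

Lemma iter_trunc_shift0 c p : (0 < c)%N -> iter c (trunc_shift c) p = 0.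
Proof.
move=> c0; apply/polyP => d; rewrite coef0; case: (ltnP d c) => [dc|cd].
  by rewrite coef_iter_trunc_shift // dc.
by case: c c0 cd => // c _ cd; rewrite iterS /trunc_shift coef_take_poly ltnNge cd.
Qed.

End ShiftExt.

(** * Normal IA-automorphisms *)

Section NormalIA.
Local Open Scope ring_scope.
Local Open Scope classical_set_scope.
Variables (K : fieldType) (m c : nat).
Notation L := (free_metanil K m c).
Notation x := (@metanil_gen K m c).

(** A bracket of [x_i, x_j] f_j with x_k multiplies f_j by the k-th variable, and
a bracket of b x_i with x_k adds the constant b to the k-th polynomial. *)
Lemma gen_ideal_form i : is_ideal [set y : L | exists b (f : 'I_m -> {mpoly K[m]}),
  y = b *: x i + \sum_j ad_poly x [lie x i, x j] (f j)].
Proof.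
apply: metanil_ideal_gen; first split.
- exists 0, (fun=> 0); rewrite scale0r add0r big1 // => j _; exact: ad_poly0r.
- move=> a _ _ [b [f ->]] [d [g ->]]; exists (a * b + d), (fun j => a *: f j + g j).
  rewrite scalerDr scalerA addrACA -scalerDl scaler_sumr -big_split /=.
  by congr (_ + _); apply: eq_bigr => j _; rewrite ad_polyP.
move=> _ k [b [f ->]]; exists 0.
exists (fun j => f j * 'X_k + (if j == k then b%:MP else 0)).
have adD u (p q : {mpoly K[m]}) : ad_poly x u (p + q) = ad_poly x u p + ad_poly x u q.
  by have := ad_polyP x u 1 p q; rewrite !scale1r.
rewrite (eq_bigr _ (fun j _ => adD _ _ _)) big_split /= scale0r add0r.
rewrite lieDl lieZl addrC /=.
rewrite (big_morph (fun w => [lie w, x k]) (fun v w => lieDl v w (x k)) (lie0l (x k))).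
congr (_ + _).
  by rewrite (bigD1 k) //= eqxx ad_polyC big1 ?addr0 // => j /negbTE ->; apply: ad_poly0r.
apply: eq_bigr => j _; apply: ad_poly_mulX; first exact: metanil_derived2.
exact: lie_derived1.
Qed.

Hypothesis c_gt0 : (0 < c)%N.

Lemma metanil_shift_hom (s : 'I_m -> K) (l : 'I_m) :
  exists2 h : L -> shift_ext (@trunc_shift K c), is_lie_hom h &
    forall j, h (x j) = (s j, (j == l)%:R).
Proof.
apply: metanil_lift; first exact: shift_ext_derived2.
case: c c_gt0 => // k _ [a p] /shift_ext_lower_central /= [-> [n ->]].
by congr pair; apply: (@iter_trunc_shift0 K k.+1 n isT).
Qed.

Lemma gen_notin_derived1 i b : derived1 L (b *: x i) -> b = 0.
Proof.
have [h hh hx] := metanil_shift_hom (fun=> 1) i.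
have d1 : derived1 L `<=` h @^-1` derived1 _ by apply: lie_hom_lie_prod.
move=> /d1/shift_ext_derived1; case: hh => hZ _ _.
by rewrite /= hZ hx /= [_ *: _]mulr1.
Qed.

Lemma normal_IA_form (phi : L -> L) : is_normal_aut phi -> is_IA_aut phi ->
  exists f : 'I_m -> 'I_m -> {mpoly K[m]},
    forall i, phi (x i) = x i + \sum_j ad_poly x [lie x i, x j] (f i j).
Proof.
move=> [_ phiI] [_ phi1].
suff F i : exists f : 'I_m -> {mpoly K[m]},
    phi (x i) = x i + \sum_j ad_poly x [lie x i, x j] (f j).
  by have [f fE] := choice F; exists f.
have [b [f E]] : [set y : L | exists b (f : 'I_m -> {mpoly K[m]}),
    y = b *: x i + \sum_j ad_poly x [lie x i, x j] (f j)] (phi (x i)).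
  rewrite -(phiI _ (gen_ideal_form i)); exists (x i) => //; exists 1, (fun=> 0).
  by rewrite scale1r big1 ?addr0 // => j _; apply: ad_poly0r.
exists f; rewrite E; congr (_ + _).
suff /eqP : b - 1 = 0 by rewrite subr_eq0 => /eqP ->; rewrite scale1r.
(* By the IA condition, (b - 1) x_i lies in the derived algebra. *)
apply: (@gen_notin_derived1 i).
have [[d0 dP] _] := derived1_ideal L.
have S1 : derived1 L (\sum_j ad_poly x [lie x i, x j] (f j)).
  have dD u v : derived1 L u -> derived1 L v -> derived1 L (u + v).
    by move=> du dv; rewrite -[u]scale1r; apply: dP.
  apply: big_ind => // j _.
  by apply: ad_poly_ideal (derived1_ideal L) _; apply: lie_derived1.
have /lie_pi_eq := phi1 (x i); rewrite E => /= D.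
have -> : (b - 1) *: x i = -1 *: (\sum_j ad_poly x [lie x i, x j] (f j)) +
    (b *: x i + \sum_j ad_poly x [lie x i, x j] (f j) - x i).
  by rewrite scalerBl scale1r scaleN1r [RHS]addrC addrAC addrK.
exact: dP.
Qed.

(** Only j = l contributes: h [x_i, x_j] involves the components of h x_i and
h x_j along N, which vanish unless i or j is l. The image of [x_i, x_l] is
- s_i t, so a monomial of degree d in f_l contributes in degree d + 1 in t. *)
Lemma coef_shift_hom_bracket (s : 'I_m -> K) (l i : 'I_m)
    (h : L -> shift_ext (@trunc_shift K c)) (f : 'I_m -> {mpoly K[m]}) d :
    is_lie_hom h -> (forall j, h (x j) = (s j, (j == l)%:R)) -> i != l -> (d.+1 < c)%N ->
  ((h (\sum_j ad_poly x [lie x i, x j] (f j))).2)`_d.+1 =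
  - s i * (pihomog mdeg d (f l)).@[s].
Proof.
move=> hh hx il dc; pose T := shift_ext (@trunc_shift K c).
have hb j : h [lie x i, x j] = (0, trunc_shift c ((- s i * (j == l)%:R)%:P)) :> T.
  case: hh => _ _ ->; rewrite !hx shift_lieE /= (negbTE il) scaler0 sub0r.
  by rewrite mulNr polyCN polyCM mul_polyC -polyC_natr.
rewrite (lie_hom_sum hh) (bigD1 l) // big1 => [|j /andP [_ jl]]; last first.
  rewrite (lie_hom_ad_poly x hh) hb (negbTE jl) mulr0 linear0 shift_ext_ad_poly.
  by rewrite big1 // => e _; rewrite iter_linear0 scaler0.
rewrite /= addr0 (lie_hom_ad_poly x hh) hb eqxx mulr1 shift_ext_ad_poly /=.
rewrite coef_sum pihomogE raddf_sum mulr_sumr [RHS]big_mkcond /=.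
apply: eq_bigr => e _; rewrite coefZ -iterSr coef_iter_trunc_shift // coefC.
rewrite mevalZ mevalX; under eq_bigr do rewrite hx /=.
rewrite ltnS subSS subn_eq0; case: ltngtP => _; rewrite ?mulr0 //.
by rewrite mulrC.
Qed.

(** A homomorphism h to K z + K[t]/(t^c) chosen to kill s_k x_i - s_i x_k also
kills its image under phi. The coefficient of t^(d+1) in that image, for
d = deg e, compares the values at s of the components of degree d of f_il and
f_kl; letting s vary over the torus identifies these components. *)
Lemma normal_coef_indep (phi : L -> L) (f : 'I_m -> 'I_m -> {mpoly K[m]}) :
    [pchar K] =i pred0 -> is_normal_aut phi ->
    (forall i, phi (x i) = x i + \sum_j ad_poly x [lie x i, x j] (f i j)) ->
  forall i k l (e : 'X_{1..m}), i != l -> k != l -> ((mdeg e).+1 < c)%N ->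
  (f i l)@_e = (f k l)@_e.
Proof.
move=> charK [[[pZ pD pL] _] phiI] phix i k l e il kl dc.
set d := mdeg e in dc.
suff E : pihomog mdeg d (f i l - f k l) = 0.
  apply/eqP; rewrite -subr_eq0 -mcoeffB; apply/eqP.
  have := congr1 (mcoeff e) E; rewrite mcoeff0 => <-.
  set g := _ - _; rewrite pihomogE raddf_sum /=.
  have [eg|eg] := boolP (e \in msupp g).
    rewrite -big_filter (bigD1_seq e) ?filter_uniq ?msupp_uniq ?mem_filter ?eqxx //=.
    rewrite mcoeffZ mcoeffX eqxx mulr1 big1 ?addr0 // => e' /negbTE ne.
    by rewrite mcoeffZ mcoeffX ne mulr0.
  rewrite (memN_msupp_eq0 eg) big_seq_cond big1 // => e' /andP [e'g _].
  by rewrite mcoeffZ mcoeffX; case: eqP e'g eg => [-> ->|]; rewrite ?mulr0.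
apply: torus_meval_eq0 => // s s0.
have [h hh hx] := metanil_shift_hom s l; case: (hh) => hZ hD _.
have kerI : is_ideal (h @^-1` [set 0]) by apply: preimage_ideal (is_ideal0 _).
(* The homomorphism h kills v, and its kernel is an ideal. *)
pose v := s k *: x i + (- s i) *: x k.
have kerv : (h @^-1` [set 0]) v.
  rewrite /preimage /set1 /= hD !hZ !hx (negbTE il) (negbTE kl).
  apply/eqP; rewrite xpair_eqE /= !scaler0 addr0 eqxx andbT.
  by rewrite /GRing.scale /= mulNr mulrC subrr.
have: (h @^-1` [set 0]) (phi v) by rewrite -(phiI _ kerI); exists v.
rewrite /preimage /set1 /= pD !pZ !phix hD !hZ !hD.
move=> /(congr1 (fun t : shift_ext (@trunc_shift K c) => t.2`_d.+1)) /=.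
rewrite !hx (negbTE il) (negbTE kl) /= !add0r coefD !coefZ coef0.
rewrite !(coef_shift_hom_bracket _ hh hx) // => /eqP.
rewrite !mulrA mulrN mulrNN mulNr [s k * _]mulrC addrC -mulrBr mulf_eq0 mulf_eq0.
rewrite (negbTE (s0 i)) (negbTE (s0 k)) /= => /eqP E.
by rewrite raddfB /= mevalB -[LHS]opprB E oppr0.
Qed.

Lemma eq_ad_poly_low (u : L) (f g : {mpoly K[m]}) : derived1 L u ->
    (forall e : 'X_{1..m}, ((mdeg e).+1 < c)%N -> f@_e = g@_e) ->
  ad_poly x u f = ad_poly x u g.
Proof.
move=> u1 fg; pose k := maxn (msize f) (msize g).
rewrite !(@ad_polywE _ _ _ _ k) ?leq_max ?leqnn ?orbT //.
apply: eq_bigr => e _; case: (ltnP (mdeg e).+1 c) => [/fg -> //|ce].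
suff -> : ad_monom x u e = 0 by rewrite !scaler0.
apply: (@metanil_lower_central K m c).
have {u1} u2 : lower_central L 2 u by [].
by apply: lower_central_le (ad_monom_lower_central x e u2).
Qed.

End NormalIA.

Theorem theorem3p4 (K : fieldType) (charK : [pchar K]%R =i pred0)
    (m c : nat) (hm : 2 <= m) (hc : 1 <= c)
    (phi : free_metanil K m c -> free_metanil K m c) :
  is_normal_aut phi -> is_IA_aut phi -> is_generalized_inner phi.
Proof.
move=> phiN phiIA; split; first by case: phiN.
have [f fE] := normal_IA_form hc phiN phiIA.
pose o (j : 'I_m) : 'I_m := if val j == 0 then Ordinal hm else Ordinal (ltnW hm).
have oj j : o j != j.
  by rewrite /o; case: ifP => [/eqP j0|/negbT j0]; rewrite -val_eqE /= ?j0 // eq_sym.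
exists (fun j => f (o j) j) => i; rewrite fE; congr (_ + _)%R.
apply: eq_bigr => j _; have [->|ij] := eqVneq i j.
  by rewrite lievv !ad_poly0l.
apply: eq_ad_poly_low => [|e ec]; first exact: lie_derived1.
exact: (normal_coef_indep hc charK phiN fE).
Qed.
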